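(* Let $S=(s_{ij})\in\mathbb{R}^{n\times n}$ be symmetric with zero diagonal, $\mu\in\mathbb{R}^n$, $H\subset\{1,\dots,n\}$, $Q=H^c$, and $v_i\in\{-1,1\}$ for $i\in H$. Let $(\mathbf{x}^{(k)},\mathbf{y}^{(k)})_{k\ge0}$ be a trajectory of the bSB clipped update (defined in the context) with parameters $\alpha_k\ge0$. Fix a step $k$ with $x_i^{(k)}=v_i$ and $y_i^{(k)}=0$ for every $i\in H$. Assume that the schedule $\{\alpha_k\}$ is non-decreasing, that $|x_j^{(k')}|\le1$ for every $j\in Q$ and every $k'\ge k$, and that at step $k$ $$(\alpha_k^2-1)+\mu_iv_i+\sum_{j\in H}s_{ij}v_iv_j>\sum_{j\in Q}|s_{ij}|\qquad\text{for all } i\in H.$$ Then $x_i^{(k')}=v_i$ and $y_i^{(k')}=0$ for every $i\in H$ and every $k'\ge k$.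
   Context: One bSB step with step size $\tau>0$ and parameter $\alpha_k$ maps $(\mathbf{x}^{(k)},\mathbf{y}^{(k)})\in\mathbb{R}^n\times\mathbb{R}^n$ to $(\mathbf{x}^{(k+1)},\mathbf{y}^{(k+1)})$ as follows: for each $i$, $$\tilde y_i=y_i^{(k)}+\tau\big((\alpha_k^2-1)x_i^{(k)}+\mu_i+(S\mathbf{x}^{(k)})_i\big),\qquad \tilde x_i=x_i^{(k)}+\tau\tilde y_i;$$ if $|\tilde x_i|>1$ then $x_i^{(k+1)}=\operatorname{sgn}(\tilde x_i)$ and $y_i^{(k+1)}=0$; if $|\tilde x_i|\le1$ then $x_i^{(k+1)}=\tilde x_i$ and $y_i^{(k+1)}=\tilde y_i$. *)

(* Defs.v *)
From mathcomp Require Import all_boot all_order all_algebra.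
From mathcomp Require Import reals.

Set Implicit Arguments.
Unset Strict Implicit.
Unset Printing Implicit Defensive.

Import Order.TTheory GRing.Theory Num.Theory.
Local Open Scope ring_scope.

(* Tentative (pre-clipping) momentum and position of one bSB step with step    *)
(* size tau and parameter a, from positions x and momenta y.                   *)
Definition bsb_ytilde (R : realType) (n : nat) (S : 'M[R]_n) (mu : 'cV[R]_n)
    (tau a : R) (x y : 'cV[R]_n) : 'cV[R]_n :=
  \col_i (y i 0 + tau * ((a ^+ 2 - 1) * x i 0 + mu i 0 + (S *m x) i 0)).

Definition bsb_xtilde (R : realType) (n : nat) (S : 'M[R]_n) (mu : 'cV[R]_n)
    (tau a : R) (x y : 'cV[R]_n) : 'cV[R]_n :=
  \col_i (x i 0 + tau * bsb_ytilde S mu tau a x y i 0).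

Definition bsb_step (R : realType) (n : nat) (S : 'M[R]_n) (mu : 'cV[R]_n)
    (tau a : R) (z : 'cV[R]_n * 'cV[R]_n) : 'cV[R]_n * 'cV[R]_n :=
  let xt := bsb_xtilde S mu tau a z.1 z.2 in
  let yt := bsb_ytilde S mu tau a z.1 z.2 in
  (\col_i (if 1 < `|xt i 0| then Num.sg (xt i 0) else xt i 0),
   \col_i (if 1 < `|xt i 0| then 0 else yt i 0)).

Definition bsb_trajectory (R : realType) (n : nat) (S : 'M[R]_n)
    (mu : 'cV[R]_n) (tau : R) (alpha : nat -> R)
    (x y : nat -> 'cV[R]_n) : Prop :=
  forall k : nat,
    (x k.+1, y k.+1) = bsb_step S mu tau (alpha k) (x k, y k).

(* Main.v *)
(* A frozen coordinate has x_i = v_i = +-1 and y_i = 0, so one step proposes   *)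
(* v_i (1 + tau^2 v_i F_i), where F_i is the force. The margin condition makes  *)
(* v_i F_i > 0 whatever the positions in [-1, 1] of the free coordinates are,   *)
(* so the proposal overshoots the wall and is clipped back to (v_i, 0). The     *)
(* margin only improves as alpha grows, so this repeats at every later step.    *)

Require Import Defs.
From mathcomp Require Import all_boot all_order all_algebra.
From mathcomp Require Import reals ring lra.

Import Order.TTheory GRing.Theory Num.Theory.
Local Open Scope ring_scope.

(** The invariant is that all of [H] is frozen at once, since the force on one coordinate of [H]
    involves the others. [frozen_force_gt0] gets the outward force from the margin,
    [bsb_step_frozen] turns it into clipping, and induction on time propagates the invariant. *)

Lemma frozen_force_gt0 (R : realType) (n : nat) (S : 'M[R]_n) (mu : 'cV[R]_n)
    (H : {set 'I_n}) (v : 'I_n -> R) (a : R) (x : 'cV[R]_n) (i : 'I_n) :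
    v i = -1 \/ v i = 1 ->
    x i 0 = v i ->
    (forall j, j \in H -> x j 0 = v j) ->
    (forall j, j \in ~: H -> `|x j 0| <= 1) ->
    \sum_(j in ~: H) `|S i j| <
      (a ^+ 2 - 1) + mu i 0 * v i + \sum_(j in H) S i j * v i * v j ->
  0 < v i * ((a ^+ 2 - 1) * x i 0 + mu i 0 + (S *m x) i 0).
Proof.
move=> vi1 xi xH xQ margin.
have norm_vi : `|v i| = 1 by case: vi1 => ->; rewrite ?normrN normr1.
have sqr_vi : v i * v i = 1 by case: vi1 => ->; ring.
have Sx : v i * (S *m x) i 0 = \sum_(j in H) S i j * v i * v j
    + \sum_(j in ~: H) v i * (S i j * x j 0).
  rewrite mxE mulr_sumr (bigID (mem H)) /=; congr (_ + _).
    by apply: eq_bigr => j jH; rewrite xH //; ring.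
  by apply: eq_bigl => j; rewrite inE.
(* Worst case over the free coordinates: [|v i * x j 0| <= 1] bounds each term below by
   [- |S i j|]. *)
have free_ge : - \sum_(j in ~: H) `|S i j|
    <= \sum_(j in ~: H) v i * (S i j * x j 0).
  rewrite -sumrN; apply: ler_sum => j /xQ xj.
  apply: lerNnormlW; rewrite !normrM norm_vi mul1r.
  exact: ler_piMr.
rewrite !mulrDr Sx xi mulrCA sqr_vi mulr1 [v i * mu i 0]mulrC.
lra.
Qed.

Lemma bsb_step_frozen (R : realType) (n : nat) (S : 'M[R]_n) (mu : 'cV[R]_n)
    (tau a : R) (x y : 'cV[R]_n) (w : R) (i : 'I_n) :
    0 < tau -> w = -1 \/ w = 1 ->
    x i 0 = w -> y i 0 = 0 ->
    0 < w * ((a ^+ 2 - 1) * x i 0 + mu i 0 + (S *m x) i 0) ->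
  let z := bsb_step S mu tau a (x, y) in z.1 i 0 = w /\ z.2 i 0 = 0.
Proof.
move=> tau_gt0 w1 xi yi force_gt0 /=.
set F := (X in w * X) in force_gt0.
have xt : bsb_xtilde S mu tau a x y i 0 = w * (1 + tau ^+ 2 * (w * F)).
  (* [mxE] also expands the product [S *m x]; it is folded back so that [F] reappears. The identity
     then rests on [w * w = 1]. *)
  rewrite !mxE yi -[\sum_j _]/(\sum_j S i j * x j 0).
  have -> : \sum_j S i j * x j 0 = (S *m x) i 0 by rewrite mxE.
  rewrite -/F xi; case: w1 => ->; ring.
have gain_gt0 : 0 < tau ^+ 2 * (w * F) by rewrite mulr_gt0 ?exprn_gt0.
have big : 1 < `|bsb_xtilde S mu tau a x y i 0|.
  rewrite xt normrM (_ : `|w| = 1) ?mul1r; last first.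
    by case: w1 => ->; rewrite ?normrN normr1.
  by rewrite gtr0_norm ?ltrDl ?addr_gt0.
split; rewrite mxE big // xt sgrM (gtr0_sg (addr_gt0 ltr01 gain_gt0)) mulr1.
by case: w1 => ->; rewrite ?sgrN sgr1.
Qed.

Theorem corollary7 (R : realType) (n : nat) (S : 'M[R]_n) (mu : 'cV[R]_n)
    (H : {set 'I_n}) (v : 'I_n -> R) (tau : R) (alpha : nat -> R)
    (x y : nat -> 'cV[R]_n) (k : nat)
    (S_sym : S^T = S)
    (S_diag : forall i : 'I_n, S i i = 0)
    (v_pm1 : forall i : 'I_n, i \in H -> v i = -1 \/ v i = 1)
    (tau_gt0 : 0 < tau)
    (alpha_ge0 : forall l : nat, 0 <= alpha l)
    (traj : bsb_trajectory S mu tau alpha x y)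
    (frozen_k : forall i : 'I_n, i \in H -> x k i 0 = v i /\ y k i 0 = 0)
    (alpha_ndecr : forall l m : nat, (l <= m)%N -> alpha l <= alpha m)
    (Q_bounded : forall (j : 'I_n) (k' : nat),
        j \in ~: H -> (k <= k')%N -> `|x k' j 0| <= 1)
    (margin : forall i : 'I_n, i \in H ->
        (alpha k ^+ 2 - 1) + mu i 0 * v i + \sum_(j in H) S i j * v i * v j
          > \sum_(j in ~: H) `|S i j|) :
  forall (i : 'I_n) (k' : nat), i \in H -> (k <= k')%N ->
    x k' i 0 = v i /\ y k' i 0 = 0.
Proof.
move=> i k' iH le_kk'.
(* [i] is generalized so that the induction hypothesis covers every coordinate of [H]. *)
elim: k' le_kk' i iH => [|m IHm] le_km i iH.
  by move: le_km; rewrite leqn0 => /eqP k0; have := frozen_k i iH; rewrite k0.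
move: le_km; rewrite leq_eqVlt => /predU1P[<-|le_km]; first exact: frozen_k.
have {}IHm := IHm le_km.
have [xi yi] := IHm i iH.
have := bsb_step_frozen _ _ S mu _ (alpha m) _ _ _ _ tau_gt0 (v_pm1 i iH) xi yi.
rewrite -traj; apply.
apply: (@frozen_force_gt0 _ _ _ _ H v) => //; first exact: v_pm1.
- by move=> j /IHm[].
- by move=> j jQ; apply: Q_bounded.
(* Only the [alpha] term of the margin depends on time, and squaring is monotone on nonnegative
   reals. *)
apply: lt_le_trans (margin i iH) _.
by rewrite !lerD2r ler_sqr ?nnegrE ?alpha_ge0 // alpha_ndecr.
Qed.
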